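(* Let $\vec{B}=\langle B_{\alpha}^{n} : \alpha<\omega_1,\ n<\omega\rangle$ be a $\diamondsuit^{*}$-sequence. Then the sequence $\vec{A}$ derived from $\vec{B}$ is a $\clubsuit_{F}$-sequence.
   Context: $\operatorname{acc}(\omega_1)$ denotes the set of nonzero limit ordinals below $\omega_1$. A $\diamondsuit^{*}$-sequence is a sequence $\langle B_{\alpha}^{n} : \alpha<\omega_1,\ n<\omega\rangle$ with $B_\alpha^n\subseteq\alpha$ such that for every $X\subseteq\omega_1$ there is a club $C\subseteq\omega_1$ such that for all $\alpha\in C$ we have $X\cap\alpha = B_\alpha^{n}$ for some $n\in\omega$. The sequence derived from $\vec B$ is $\vec A=\langle A_\alpha^n:\alpha<\omega_1,\ n<\omega\rangle$ with $A_\alpha^n=B_\alpha^n$ if $B_\alpha^n$ is unbounded in $\alpha$, and $A_\alpha^n=\alpha$ otherwise. A sequence $\langle A_\alpha^n:\alpha<\omega_1,\ n<\omega\rangle$ is a $\clubsuit_F$-sequence if (1) for all $\alpha\in\operatorname{acc}(\omega_1)$ and $n\in\omega$, $A_\alpha^n$ is an unbounded subset of $\alpha$; and (2) for every $f:\omega_1\to\omega$ there are $\alpha\in\operatorname{acc}(\omega_1)$ and $n,m\in\omega$ such that $\alpha\in f^{-1}[\{n\}]$ and $A_\alpha^m\subseteq f^{-1}[\{n\}]$. *)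

(* Defs.v *)
From HB Require Import structures.
From mathcomp Require Import all_boot all_order.
From mathcomp Require Import boolp classical_sets functions cardinality wochoice.

Set Implicit Arguments.
Unset Strict Implicit.
Unset Printing Implicit Defensive.

Import Order.TTheory.
Local Open Scope classical_set_scope.
Local Open Scope order_scope.

(* This determines the ordered set omega_1 up to a unique isomorphism: an
   uncountable well-order all of whose proper initial segments are countable. *)
Definition is_omega1 d (T : orderType d) : Prop :=
  [/\ well_order (<=%O : rel T),
      forall a : T, countable [set b : T | b < a]
    & ~ countable [set: T]].

Section Omega1.
Context d (T : orderType d).
Implicit Types (a b c : T) (X C : set T).

(* The von Neumann ordinal a is the set of smaller ordinals. *)
Definition below a : set T := [set b | b < a].

(* sup (X `&` below a) = a, so no set is unbounded in a successor; at limits it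
   does not matter whether b < c or b <= c is required. *)
Definition unbounded_in X a : Prop :=
  forall b, b < a -> exists2 c, X c & b < c < a.

Definition acc : set T :=
  [set a | (exists b, b < a) /\ (forall b, b < a -> exists c, b < c < a)].

Definition club C : Prop :=
  (forall b, exists2 c, C c & b < c) /\
  (forall a, acc a -> unbounded_in C a -> C a).

Definition diamond_star (B : T -> nat -> set T) : Prop :=
  (forall a n, B a n `<=` below a) /\
  (forall X, exists2 C, club C &
     forall a, C a -> exists n, X `&` below a = B a n).

Definition derived (B : T -> nat -> set T) : T -> nat -> set T :=
  fun a n => if `[< unbounded_in (B a n) a >] then B a n else below a.

Definition club_F (A : T -> nat -> set T) : Prop :=
  (forall a n, acc a -> A a n `<=` below a /\ unbounded_in (A a n) a) /\
  (forall f : T -> nat, exists a n m,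
     [/\ acc a, (f @^-1` [set n]) a & A a m `<=` f @^-1` [set n]]).

End Omega1.

(* Main.v *)
Require Import Defs.
From mathcomp Require Import all_boot all_order.
From mathcomp Require Import boolp classical_sets functions cardinality wochoice.

(** Countably many conditions hold at once at some limit ordinal [a]: it is
    above every bounded fibre of [f], a limit of every unbounded one, and in the
    guessing club of each. The fibre [X] containing [a] then cannot be bounded,
    so it is unbounded in [a], and the set guessing [X] at [a] is kept in the
    derived sequence. *)

Import Order.TTheory.
Local Open Scope classical_set_scope.
Local Open Scope order_scope.

(** If no point lay strictly above the family, every point would equal or precede some [F i], making
    [T] a countable union of countable sets. *)
Lemma omega1_countable_lt {d : Order.disp_t} {T : orderType d} {I : countType}
    (F : I -> T) :
  is_omega1 T -> exists a, forall i, F i < a.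
Proof.
move=> [_ cnt_below uncountT]; apply: contrapT => unboundF; apply: uncountT.
pose below_or_eq (p : I * bool) :=
  if p.2 then below (F p.1) else [set F p.1].
have -> : [set: T] = \bigcup_p below_or_eq p.
  apply/seteqP; split=> // a _; apply: contrapT => Fa; apply: unboundF.
  exists a => i; rewrite ltNge; apply/negP; rewrite le_eqVlt => /orP le_aF.
  by apply: Fa; case: le_aF => [/eqP|]; [exists (i, false)|exists (i, true)].
apply: bigcup_countable => // -[i []] _; first exact: cnt_below.
exact: countable1.
Qed.

Lemma omega1_lub {d : Order.disp_t} {T : orderType d} (x : nat -> T) :
  is_omega1 T ->
  exists2 a, (forall k, x k <= a) &
    forall b, b < a -> exists k, b < x k.
Proof.
move=> omega1T; have [e lt_xe] := omega1_countable_lt x omega1T.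
have [wo _ _] := omega1T.
have [|a [[/asboolP ub_a min_a] _]] := wo [pred a | `[< forall k, x k <= a >]].
  by exists e; apply/asboolP => k; apply: ltW.
exists a => // b lt_ba; apply: contrapT => /forallNP x_le_b.
have /min_a : b \in [pred a | `[< forall k, x k <= a >]].
  by apply/asboolP => k; rewrite leNgt; apply/negP/x_le_b.
by rewrite leNgt lt_ba.
Qed.

(** Closing off: each step moves from [b] to a larger [b'] that, for every [i] at once, bounds [S i]
    or leaves a point of [S i] in between. The supremum of countably many iterated steps is the
    required limit. *)
Lemma omega1_acc_reflect {d : Order.disp_t} {T : orderType d} {I : countType}
    (S : I -> set T) :
  is_omega1 T ->
  exists2 a, acc a & forall i, S i `<=` below a \/ unbounded_in (S i) a.
Proof.
move=> omega1T.
have step b : exists b', b < b' /\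
    forall i, S i `<=` below b' \/ exists2 c, S i c & b < c < b'.
  have /choice[c cP] (i : I) : exists c, S i `<=` below c \/ S i c /\ b < c.
    case: (pselect (exists c, S i c /\ b < c)) => [[c Sc]|noS].
      by exists c; right.
    (* No point of [S i] exceeds [b], so any [c] above [b] bounds [S i]. *)
    have [c lt_bc] := omega1_countable_lt (fun _ : unit => b) omega1T.
    exists c; left=> e Se; apply: le_lt_trans (lt_bc tt).
    by rewrite leNgt; apply/negP => lt_be; apply: noS; exists e.
  (* The extra index [None] puts [b] itself below [b']. *)
  have [b' lt_b'] :=
    omega1_countable_lt (fun o => if o is Some i then c i else b) omega1T.
  exists b'; split=> [|i]; first exact: lt_b' None.
  case: (cP i) => [Sc|[Sc lt_bc]].
    by left=> e /Sc lt_ec; apply: lt_trans (lt_b' (Some i)).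
  by right; exists (c i) => //; rewrite lt_bc; apply: lt_b' (Some i).
have [next nextP] := choice step.
(* A bound of the empty family serves as starting point. *)
have [x0 _] := omega1_countable_lt (fun v : void => match v with end) omega1T.
pose x k := iter k next x0.
have lt_x k : x k < x k.+1 := (nextP (x k)).1.
have [a x_le_a lt_a_x] := omega1_lub x omega1T.
have lt_x_a k : x k < a := lt_le_trans (lt_x k) (x_le_a k.+1).
exists a.
  split; first by exists (x 0%N).
  by move=> b /lt_a_x[k lt_bx]; exists (x k); rewrite lt_bx lt_x_a.
move=> i; case: (pselect (exists k, S i `<=` below (x k))) => [[k Sx]|noSx].
  by left=> c /Sx lt_cx; apply: lt_trans (lt_x_a k).
(* No [x k] bounds [S i], so each step caught a point of [S i], and the [x k] are cofinal in [a]. *)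
right=> b /lt_a_x[k lt_bx].
have [Sx|[c Sc /andP[lt_xc lt_cx]]] := (nextP (x k)).2 i.
  by case: noSx; exists k.+1.
by exists c => //; rewrite (lt_trans lt_bx lt_xc) (lt_trans lt_cx (lt_x_a k.+1)).
Qed.

Theorem lemma3p5 (d : Order.disp_t) (T : orderType d) (omega1T : is_omega1 T)
    (B : T -> nat -> set T) :
  diamond_star B -> club_F (derived B).
Proof.
move=> [B_below guess]; split=> [a n [_ acc_a]|f].
  rewrite /derived; case: asboolP => [unbB|_]; first by split.
  (* The default value [below a] is unbounded because [a] is a limit. *)
  by split=> // b /acc_a[c lt_bca]; exists c => //; case/andP: lt_bca.
have /choice[C CP] n : exists C, club C /\
    forall a, C a -> exists m, (f @^-1` [set n]) `&` below a = B a m.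
  by have [C clubC guessC] := guess (f @^-1` [set n]); exists C.
have [a acc_a reflect_a] := omega1_acc_reflect
  (fun s : nat + nat =>
     match s with inl n => C n | inr n => f @^-1` [set n] end) omega1T.
have Ca n : C n a.
  have [[unbC closedC] _] := CP n; apply: closedC => //.
  (* A club has points above [a], so it cannot lie below [a]. *)
  have [Ca|//] := reflect_a (inl n).
  by have [c /Ca lt_ca /(lt_trans lt_ca)] := unbC a; rewrite ltxx.
have [fa_below|unb_fa] := reflect_a (inr (f a)).
  by have := fa_below a erefl; rewrite /below /= ltxx.
have [m Bm] := (CP (f a)).2 a (Ca (f a)).
(* Unboundedness in [a] concerns only points below [a], so it passes from the fibre to its trace
   [B a m]. *)
exists a, (f a), m; split=> //; rewrite /derived asboolT -?Bm => [|b /unb_fa].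
  by move=> c [].
by move=> [c fc lt_bca]; exists c => //; split=> //; case/andP: lt_bca.
Qed.
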